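(* Let $a,b,c,d$ be constants (e.g. complex numbers) and let $E(x)$ be the unique formal power series solution of \[ E(x) = \frac{a}{E(x)x^2(dx^2 - bx - 1) + cx^2 + bx + 1}. \] If $H_n(E)\neq 0$ for all $n\ge 0$, then for all $n\ge 0$ \begin{align*} H_{2n+1}(E) &=a^{(n+1)^2} (c + d - a)^{n^2}B_n(a,c,d),\\ H_{2n}(E) &=(-1)^na^{n(n+1)} (c + d - a) ^{n(n-1)}B_n(a,c,d). \end{align*}
   Context: For a formal power series $A(x)=\sum_{n\ge0}a_nx^n$, the Hankel determinant is $H_n(A(x))=\det(a_{i+j})_{0\le i,j\le n-1}$, with $H_0(A(x))=1$. For constants $a,c,d$, the sequence $B_n(a,c,d)$ is defined by $B_0=1$, $B_1=c-a$, and $B_{n+1}=\beta B_n+\alpha B_{n-1}$ for $n\ge1$, where $\alpha=a(c+d-a)$ and $\beta=c-2a$. *)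

(* Defs.v *)
(* boolp provides extensionality and a choice structure for sequences. *)
From HB Require Import structures.
From mathcomp Require Import all_boot all_order all_algebra.
From mathcomp Require Import boolp.
From mathcomp Require Import ring.

Set Implicit Arguments.
Unset Strict Implicit.
Unset Printing Implicit Defensive.

Import GRing.Theory.
Local Open Scope ring_scope.

(* A formal power series over R is the sequence of its coefficients.  It is
   wrapped in a record so that it does not inherit the pointwise operations on
   functions [nat -> R]. *)
Record fps (R : Type) : Type := Fps { coefs : nat -> R }.
Coercion coefs : fps >-> Funclass.

HB.instance Definition _ (R : Type) := gen_eqMixin (fps R).
HB.instance Definition _ (R : Type) := gen_choiceMixin (fps R).

Lemma fpsP (R : Type) (f g : fps R) : (forall n, f n = g n) -> f = g.
Proof. by case: f g => f [g] /= fg; congr Fps; apply/funext. Qed.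

Definition fps_zero (R : nmodType) : fps R := Fps (fun=> 0).
Definition fps_opp (R : zmodType) (f : fps R) : fps R := Fps (fun n => - f n).
Definition fps_add (R : nmodType) (f g : fps R) : fps R :=
  Fps (fun n => f n + g n).

Fact fps_addA (R : nmodType) : associative (@fps_add R).
Proof. by move=> f g h; apply: fpsP => n /=; rewrite addrA. Qed.
Fact fps_addC (R : nmodType) : commutative (@fps_add R).
Proof. by move=> f g; apply: fpsP => n /=; rewrite addrC. Qed.
Fact fps_add0 (R : nmodType) : left_id (@fps_zero R) (@fps_add R).
Proof. by move=> f; apply: fpsP => n /=; rewrite add0r. Qed.
Fact fps_addN (R : zmodType) :
  left_inverse (@fps_zero R) (@fps_opp R) (@fps_add R).
Proof. by move=> f; apply: fpsP => n /=; rewrite addNr. Qed.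

HB.instance Definition _ (R : zmodType) := GRing.isZmodule.Build (fps R)
  (@fps_addA R) (@fps_addC R) (@fps_add0 R) (@fps_addN R).

Definition fpsC (R : nmodType) (c : R) : fps R :=
  Fps (fun n => if n == 0%N then c else 0).

Definition fpsX (R : nzRingType) : fps R := Fps (fun n => (n == 1%N)%:R).
Arguments fpsX {R}.

Definition fps_mul (R : nzRingType) (f g : fps R) : fps R :=
  Fps (fun n => \sum_(i < n.+1) f i * g (n - i)%N).

Definition fps_trunc (R : nzRingType) (N : nat) (f : fps R) : {poly R} :=
  \poly_(i < N) f i.

Lemma fps_mulE (R : nzRingType) (f g : fps R) (N n : nat) : (n < N)%N ->
  fps_mul f g n = (fps_trunc N f * fps_trunc N g)`_n.
Proof.
move=> ltnN; rewrite coefM; apply: eq_bigr => -[i /= lein] _.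
by rewrite !coef_poly (leq_trans lein ltnN) (leq_ltn_trans (leq_subr i n) ltnN).
Qed.

Fact fps_mulC (R : comNzRingType) : commutative (@fps_mul R).
Proof.
by move=> f g; apply: fpsP => n; rewrite !(fps_mulE _ _ (ltnSn n)) mulrC.
Qed.

Fact fps_mulA (R : comNzRingType) : associative (@fps_mul R).
Proof.
move=> f g h; apply: fpsP => n.
transitivity ((fps_trunc n.+1 f * (fps_trunc n.+1 g * fps_trunc n.+1 h))`_n).
  rewrite coefM; apply: eq_bigr => i _.
  by rewrite coef_poly ltn_ord -fps_mulE // ltnS leq_subr.
rewrite mulrA coefMr /= -(big_mkord xpredT (fun i =>
  (fps_trunc n.+1 f * fps_trunc n.+1 g)`_(n - i) * (fps_trunc n.+1 h)`_i)).
rewrite big_nat_rev /= big_mkord; apply: eq_bigr => -[i /= ltin] _.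
rewrite add0n subSS subKn // -fps_mulE // coef_poly.
by rewrite ltnS leq_subr.
Qed.

Fact fps_mul1 (R : nzRingType) : left_id (fpsC (1 : R)) (@fps_mul R).
Proof.
move=> f; apply: fpsP => n /=.
by rewrite big_ord_recl /= mul1r subn0 big1 ?addr0 // => i _; rewrite mul0r.
Qed.

Fact fps_mulDl (R : nzRingType) : left_distributive (@fps_mul R) +%R.
Proof.
move=> f g h; apply: fpsP => n /=; rewrite -big_split /=.
by apply: eq_bigr => i _; rewrite mulrDl.
Qed.

Fact fps_one_neq0 (R : nzRingType) : fpsC (1 : R) != 0.
Proof.
apply/eqP => /(congr1 (fun f : fps R => f 0%N)) /= /eqP.
by rewrite (negPf (oner_neq0 R)).
Qed.

HB.instance Definition _ (R : comNzRingType) :=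
  GRing.Zmodule_isComNzRing.Build (fps R)
    (@fps_mulA R) (@fps_mulC R) (@fps_mul1 R) (@fps_mulDl R) (fps_one_neq0 R).

(* The first n + 1 coefficients g_0, ..., g_n of the inverse of f, given by
   g_0 = f_0^-1 and g_(k+1) = - f_0^-1 (f_1 g_k + ... + f_(k+1) g_0). *)
Fixpoint fps_inv_seq (R : unitRingType) (f : fps R) (n : nat) : seq R :=
  if n is m.+1 then
    let s := fps_inv_seq f m in
    rcons s (- ((f 0%N)^-1 * \sum_(i < n) f i.+1 * s`_(m - i)))
  else [:: (f 0%N)^-1].

Definition fps_unit (R : unitRingType) : pred (fps R) :=
  fun f => f 0%N \is a GRing.unit.

(* MathComp requires the inverse of a non-unit to be the element itself. *)
Definition fps_inv (R : unitRingType) (f : fps R) : fps R :=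
  if fps_unit f then Fps (fun n => (fps_inv_seq f n)`_n) else f.

Lemma size_fps_inv_seq (R : unitRingType) (f : fps R) n :
  size (fps_inv_seq f n) = n.+1.
Proof. by elim: n => //= n IHn; rewrite size_rcons IHn. Qed.

Lemma nth_fps_inv_seq (R : unitRingType) (f : fps R) n k : (k <= n)%N ->
  (fps_inv_seq f n)`_k = (fps_inv_seq f k)`_k.
Proof.
elim: n => [|n IHn]; first by case: k.
rewrite leq_eqVlt => /orP[/eqP -> //|]; rewrite ltnS => lekn.
by rewrite /= nth_rcons size_fps_inv_seq ltnS lekn IHn.
Qed.

Fact fps_mulVx (R : comUnitRingType) :
  {in @fps_unit R, left_inverse 1 (@fps_inv R) *%R}.
Proof.
move=> f Uf; rewrite mulrC /fps_inv (_ : fps_unit f) //.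
have {}Uf : f 0%N \is a GRing.unit by [].
apply: fpsP => -[|n] /=; first by rewrite big_ord1 divrr.
rewrite big_ord_recl /= subn0 nth_rcons size_fps_inv_seq ltnn eqxx.
rewrite mulrN mulrA divrr // mul1r addrC; apply/eqP; rewrite subr_eq0.
apply/eqP/eq_bigr => i _; rewrite /bump leq0n add1n subSS.
by rewrite [in RHS]nth_fps_inv_seq // leq_subr.
Qed.

Fact fps_unitPl (R : comUnitRingType) (f g : fps R) : g * f = 1 -> fps_unit f.
Proof.
move=> /(congr1 (fun h : fps R => h 0%N)) /=; rewrite big_ord1 subnn => gf1.
by apply/unitrPr; exists (g 0%N); rewrite mulrC.
Qed.

Fact fps_inv_out (R : comUnitRingType) :
  {in [predC @fps_unit R], @fps_inv R =1 id}.
Proof. by move=> f; rewrite /fps_inv inE -topredE /= => /negPf ->. Qed.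

HB.instance Definition _ (R : comUnitRingType) :=
  GRing.ComNzRing_hasMulInverse.Build (fps R)
    (@fps_mulVx R) (@fps_unitPl R) (@fps_inv_out R).

Definition hankel (R : comNzRingType) (A : fps R) (n : nat) : R :=
  \det (\matrix_(i < n, j < n) A (i + j)%N).

Fixpoint seqB (R : pzRingType) (a c d : R) (n : nat) : R :=
  match n with
  | 0 => 1
  | 1 => c - a
  | (m.+1 as k).+1 =>
      (c - 2 * a) * seqB a c d k + a * (c + d - a) * seqB a c d m
  end.

(* The denominator has constant term 1, hence is a unit, and the equation
   determines E: its right-hand side is contractive in E. *)
Definition E_denom (R : comNzRingType) (b c d : R) (E : fps R) : fps R :=
  E * fpsX ^+ 2 * (fpsC d * fpsX ^+ 2 - fpsC b * fpsX - 1)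
  + fpsC c * fpsX ^+ 2 + fpsC b * fpsX + 1.

Lemma fps_mulX0 (R : comNzRingType) (f : fps R) : (f * fpsX) 0%N = 0.
Proof. by rewrite /= big_ord1 mulr0. Qed.

Lemma fps_mulXS (R : comNzRingType) (f : fps R) n : (f * fpsX) n.+1 = f n.
Proof.
rewrite /= big_ord_recr /= big_ord_recr /= big1 ?add0r; last first.
  case=> i /= ltin _; rewrite (_ : (n.+1 - i == 1)%N = false) ?mulr0 //.
  by rewrite subSn ?(ltnW ltin) // eqSS subn_eq0 leqNgt ltin.
by rewrite subSnn subnn mulr1 mulr0 addr0.
Qed.

Lemma E_denom_unit (R : comUnitRingType) (b c d : R) (E : fps R) :
  E_denom b c d E \is a GRing.unit.
Proof.
suff -> : E_denom b c d E =
  (E * fpsX * (fpsC d * fpsX ^+ 2 - fpsC b * fpsX - 1)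
   + fpsC c * fpsX + fpsC b) * fpsX + 1; last by rewrite /E_denom; ring.
rewrite unfold_in /=; have := fps_mulX0 (E * fpsX *
   (fpsC d * fpsX ^+ 2 - fpsC b * fpsX - 1) + fpsC c * fpsX + fpsC b).
by rewrite /fps_unit /= => ->; rewrite add0r unitr1.
Qed.

Definition fps_small (R : zmodType) (N : nat) (f : fps R) :=
  forall i, (i < N)%N -> f i = 0.

Lemma fps_smallM (R : comNzRingType) N (f g : fps R) :
  fps_small N f -> fps_small N (f * g).
Proof.
move=> f0 i ltiN /=; rewrite big1 // => j _.
by rewrite f0 ?mul0r // (leq_trans (ltn_ord j)).
Qed.

Lemma fps_smallX (R : comNzRingType) N (f : fps R) :
  fps_small N f -> fps_small N.+1 (f * fpsX).
Proof.
by move=> f0 [|i] ltiN; rewrite ?fps_mulX0 // fps_mulXS f0.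
Qed.

Lemma E_rhs_contract (R : comUnitRingType) (a b c d : R) N (f g : fps R) :
  fps_small N (f - g) ->
  fps_small N.+1 (fpsC a / E_denom b c d f - fpsC a / E_denom b c d g).
Proof.
move=> fg0; set u := E_denom b c d f; set v := E_denom b c d g.
have Uu : u \is a GRing.unit := E_denom_unit b c d f.
have Uv : v \is a GRing.unit := E_denom_unit b c d g.
have -> : fpsC a / u - fpsC a / v = (v - u) * (fpsC a * u^-1 * v^-1).
  rewrite mulrBl; congr (_ - _); first by rewrite [RHS]mulrC mulrVK.
  by rewrite [RHS]mulrC mulrAC mulrVK.
have -> : v - u =
    (f - g) * fpsX * (- fpsX * (fpsC d * fpsX ^+ 2 - fpsC b * fpsX - 1)).
  by rewrite /u /v /E_denom; ring.
by do 2 apply: fps_smallM; apply: fps_smallX.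
Qed.

Lemma E_exists_unique (R : comUnitRingType) (a b c d : R) :
  exists! E : fps R,
    E = fpsC a / (E * fpsX ^+ 2 * (fpsC d * fpsX ^+ 2 - fpsC b * fpsX - 1)
                  + fpsC c * fpsX ^+ 2 + fpsC b * fpsX + 1).
Proof.
pose Phi (E : fps R) := fpsC a / E_denom b c d E.
pose s n := iter n Phi 0.
have ss n : fps_small n (s n.+1 - s n).
  by elim: n => [|n IHn] //; apply: E_rhs_contract.
have sE n k : (n < k)%N -> s k n = s n.+1 n.
  elim: k => // k IHk; rewrite ltnS leq_eqVlt => /orP[/eqP -> //|ltnk].
  by rewrite -IHk //; apply/eqP; rewrite -subr_eq0; apply/eqP/(ss k).
pose E := Fps (fun n => s n.+1 n).
have EP : E = Phi E.
  apply: fpsP => n; have Es : fps_small n (E - s n).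
    by move=> i ltin /=; rewrite sE ?subrr.
  have /(_ n (ltnSn n)) /= := E_rhs_contract a b c d Es.
  by move=> /eqP; rewrite subr_eq0 => /eqP ->.
exists E; split=> // E' E'P; apply: fpsP => n.
suff small N : fps_small N (E - E').
  by apply/eqP; rewrite -subr_eq0; apply/eqP/(small n.+1).
elim: N => // N IHN; rewrite EP [in X in _ - X]E'P.
exact: E_rhs_contract.
Qed.

(* Main.v *)
(* With [P := d x^2 - b x - 1], the power series [E] has the continued fraction
   expansion [E = a / (1 + b x - x^2 G)], [G = (a - c) / (1 - x^2 E')], where
   [G = - c - P E] and, for [s = a d / (c - a)], the series [E'] solves the same
   equation with [(a, c, d)] replaced by [(a + s, c + 2 s, - s)].  This change
   of parameters leaves [alpha] and [beta] invariant and multiplies [B_n] into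
   [B_(n+1) / B_1], so the formulas follow by induction from
   [H_(n+2)(E) = a^(n+2) (a - c)^(n+1) H_n(E')]. *)
Require Import Defs.
From HB Require Import structures.
From mathcomp Require Import all_boot all_order all_algebra.
From mathcomp Require Import ring zify.

Import GRing.Theory.
Local Open Scope ring_scope.

Fact fpsC_is_zmod_morphism (R : comNzRingType) :
  zmod_morphism (@fpsC R : R -> fps R).
Proof. by move=> x y; apply: fpsP => -[|n] //=; rewrite subr0. Qed.

Fact fpsC_is_monoid_morphism (R : comNzRingType) :
  monoid_morphism (@fpsC R : R -> fps R).
Proof.
split=> // x y; apply: fpsP => -[|n] /=; first by rewrite big_ord1.
rewrite big1 // => -[[|i] lti] _ /=; last by rewrite mul0r.
by rewrite mulr0.
Qed.

HB.instance Definition _ (R : comNzRingType) :=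
  GRing.isZmodMorphism.Build R (fps R) (@fpsC R) (@fpsC_is_zmod_morphism R).
HB.instance Definition _ (R : comNzRingType) :=
  GRing.isMonoidMorphism.Build R (fps R) (@fpsC R)
    (@fpsC_is_monoid_morphism R).

Lemma hankel0 (R : comNzRingType) (A : fps R) : hankel A 0 = 1.
Proof. exact: det_mx00. Qed.

(* With [f := 1 + u x - x^2 K] and [L i j := f_(i-j)], [T i j := G_(j-i)] (zero
   for negative indices), both triangular, [G * f = r] yields the factorization
   [L *m H_(n+1)(G) = diag(1, H_n(K)) *m T]. *)
Lemma hankel_cfrac (R : comNzRingType) (r u : R) (G K : fps R) (n : nat) :
  G * (1 + fpsC u * fpsX - K * fpsX ^+ 2) = fpsC r ->
  hankel G n.+1 = r ^+ n.+1 * hankel K n.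
Proof.
set f := (X in G * X) => fG.
have fE : f = 1 + (fpsC u - K * fpsX) * fpsX by rewrite /f; ring.
have f0 : f 0%N = 1.
  by rewrite fE -[LHS]/(1 + ((fpsC u - K * fpsX) * fpsX) 0%N) fps_mulX0 addr0.
have fSS m : f m.+2 = - K m.
  rewrite fE -[LHS]/(0 + ((fpsC u - K * fpsX) * fpsX) m.+2) fps_mulXS add0r.
  by rewrite -[LHS]/(0 - (K * fpsX) m.+1) fps_mulXS add0r.
have conv m : \sum_(0 <= k < m.+1) G k * f (m - k)%N = fpsC r m.
  by rewrite -fG big_mkord.
clearbody f; clear fG fE.
have G0 : G 0%N = r by have := conv 0%N; rewrite big_nat1 f0 mulr1.
pose L : 'M[R]_(1 + n) := \matrix_(i, j) if (j <= i)%N then f (i - j)%N else 0.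
pose T : 'M[R]_(1 + n) := \matrix_(i, j) if (i <= j)%N then G (j - i)%N else 0.
pose HG : 'M[R]_(1 + n) := \matrix_(i, j) G (i + j)%N.
pose HK : 'M[R]_n := \matrix_(i, j) K (i + j)%N.
have detL : \det L = 1.
  rewrite det_trig; first by apply: big1 => i _; rewrite mxE leqnn subnn.
  by apply/is_trig_mxP => i j ltij; rewrite mxE leqNgt ltij.
have detT : \det T = r ^+ n.+1.
  rewrite -det_tr det_trig.
    rewrite (eq_bigr (fun=> r)) ?prodr_const ?card_ord // => i _.
    by rewrite !mxE leqnn subnn.
  by apply/is_trig_mxP => i j ltij; rewrite !mxE leqNgt ltij.
suff LH : L *m HG = lift0_mx HK *m T.
  have := congr1 determinant LH; rewrite !det_mulmx detL detT mul1r.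
  by rewrite det_lblock det1 mul1r mulrC.
have rowL (i l : 'I_(1 + n)) :
    (L *m HG) i l = \sum_(0 <= k < i.+1) f (i - k)%N * G (k + l)%N.
  rewrite mxE (big_nat_widen _ _ (1 + n)) //= big_mkord [RHS]big_mkcond /=.
  by apply: eq_bigr => k _; rewrite !mxE ltnS; case: leqP; rewrite ?mul0r.
apply/matrixP => i l; rewrite rowL.
rewrite mxE big_split_ord /= big_ord1.
(* Row 0 of both products has entries [G_l]. Row [i' + 1] of the right-hand product is row [i'] of
   [HK] against the shifted columns of [T]. *)
rewrite -[i in RHS]splitK; case: splitP => {}i' /= ->.
  rewrite ord1 big_nat1 f0 mul1r add0n block_mxEul !mxE subn0 mul1r.
  by rewrite big1 ?addr0 // => k _; rewrite block_mxEur mxE mul0r.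
rewrite block_mxEdl mxE mul0r add0r.
transitivity (\sum_(0 <= k < l) K (i' + k)%N * G (l - k.+1)%N); last first.
  have lel : (l <= n)%N by rewrite -ltnS ltn_ord.
  rewrite (big_nat_widen _ _ n) //= big_mkord [LHS]big_mkcond /=.
  apply: eq_bigr => k _; rewrite block_mxEdr !mxE -[(rshift 1 k : nat)]/k.+1.
  by case: ltnP => _; rewrite ?mulr0.
(* The coefficient of [G * f = r] at the positive index [l + i' + 1] vanishes. Its terms with
   [k >= l] form the entry of [L *m HG]; those with [k < l] carry [f] at an index at least 2, hence
   a coefficient of [- K]. *)
have := conv (l + i'.+1)%N; rewrite (big_cat_nat (n := l)) //=; last by lia.
rewrite addnS -{3}[val l]add0n big_addn.
rewrite (_ : (l + i').+2 - l = i'.+2)%N; last by lia.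
move/eqP; rewrite addrC addr_eq0 => /eqP convE.
transitivity
  (\sum_(0 <= k < i'.+2) G (k + l)%N * f ((l + i').+1 - (k + l))%N); last first.
  rewrite convE big_nat_rev /= -sumrN; apply: eq_big_nat => k /andP[_ ltk].
  rewrite add0n (_ : (l + i').+1 - (l - k.+1) = (i' + k).+2)%N; last by lia.
  by rewrite fSS mulrN opprK mulrC.
apply: eq_big_nat => k _; rewrite mulrC; congr (_ * f _); lia.
Qed.

(** Both sides satisfy the same two-term recurrence, as alpha and beta are invariant, so it suffices
    that they agree at two consecutive indices; hence the paired induction. *)
Lemma seqB_step (F : fieldType) (a c d s : F) (n : nat) :
  a * d = s * (c - a) ->
  seqB a c d n.+1 = (c - a) * seqB (a + s) (c + 2 * s) (- s) n.
Proof.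
move=> sE.
suff: seqB a c d n.+1 = (c - a) * seqB (a + s) (c + 2 * s) (- s) n /\
      seqB a c d n.+2 = (c - a) * seqB (a + s) (c + 2 * s) (- s) n.+1 by case.
elim: n => [|n [IH1 IH2]]; first by split=> /=; ring: sE.
have seqBSS a' c' d' m : seqB a' c' d' m.+2 =
    (c' - 2 * a') * seqB a' c' d' m.+1 + a' * (c' + d' - a') * seqB a' c' d' m.
  by [].
split=> //.
rewrite [LHS]seqBSS IH1 IH2 [in RHS]seqBSS.
by ring: sE.
Qed.

Lemma E_step (F : fieldType) (a b c d s : F) (E : fps F) :
  a * d = s * (c - a) ->
  E * E_denom b c d E = fpsC a ->
  exists2 E' : fps F,
    E' * E_denom b (c + 2 * s) (- s) E' = fpsC (a + s) &
    forall n, hankel E n.+2 = a ^+ n.+2 * (a - c) ^+ n.+1 * hankel E' n.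
Proof.
move=> sE EP.
have sE' : fpsC a * fpsC d = fpsC s * (fpsC c - fpsC a) :> fps F.
  by rewrite -rmorphB -!rmorphM sE.
pose P : fps F := fpsC d * fpsX ^+ 2 - fpsC b * fpsX - 1.
pose G : fps F := - fpsC c - P * E.
(* [D] is [- P] for the new parameter [- s] in place of [d]. *)
pose D : fps F := (fpsC s * fpsX + fpsC b) * fpsX + 1.
have UD : D \is a GRing.unit.
  rewrite unfold_in /= /fps_unit -[D 0%N]/(((_ * fpsX) 0%N) + 1).
  by rewrite fps_mulX0 add0r unitr1.
(* Chosen so that the analogue of [G] for the new parameters, [- (c + 2 s) + D E'], equals
   [G - s]. *)
pose E' := (G + fpsC c + fpsC s) / D.
have E'D : E' * D = G + fpsC c + fpsC s by rewrite /E' mulrVK.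
have E_cfrac : E * (1 + fpsC b * fpsX - G * fpsX ^+ 2) = fpsC a.
  by rewrite -EP /G /P /E_denom; ring.
have G_cfrac : G * (1 + fpsC 0 * fpsX - E' * fpsX ^+ 2) = fpsC (a - c).
  (* After multiplication by [D] the left side becomes [(a - c) (1 + b x) - a d x^2], and
     [a d = s (c - a)] makes this [(a - c) D]. *)
  apply: (mulIr UD); rewrite rmorph0 rmorphB.
  transitivity (G * (D - (E' * D) * fpsX ^+ 2)); first by ring.
  transitivity (- fpsC c * (1 + fpsC b * fpsX) - P * (E * E_denom b c d E)).
    by rewrite E'D /D /G /P /E_denom; ring.
  by rewrite EP /P /D; ring: sE'.
exists E' => [|n].
  transitivity (G * (1 + fpsC 0 * fpsX - E' * fpsX ^+ 2) + fpsC c + fpsC s).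
    have -> : G = E' * D - fpsC c - fpsC s by rewrite E'D; ring.
    rewrite /E_denom /D !(rmorphD, rmorphM, rmorphN, rmorph1, rmorph0) /=.
    by ring.
  by rewrite G_cfrac rmorphB rmorphD; ring.
by rewrite (hankel_cfrac _ _ _ _ _ _ E_cfrac)
  (hankel_cfrac _ _ _ _ _ _ G_cfrac) mulrA.
Qed.

Lemma hankel1_E (F : fieldType) (a b c d : F) (E : fps F) :
  E * E_denom b c d E = fpsC a -> hankel E 1 = a.
Proof.
move=> EP; have := hankel_cfrac F a b E
  (- fpsC c - (fpsC d * fpsX ^+ 2 - fpsC b * fpsX - 1) * E) 0.
rewrite hankel0 mulr1 expr1; apply.
by rewrite -EP /E_denom; ring.
Qed.

(** The factor [a - c] lets [H_2(E) <> 0] justify the division by [c - a] that defines [s]. *)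
Lemma hankel2_E (F : fieldType) (a b c d : F) (E : fps F) :
  E * E_denom b c d E = fpsC a -> hankel E 2 = a ^+ 2 * (a - c).
Proof.
move=> EP; have H1 := hankel1_E _ _ _ _ _ _ EP.
(* This [G] is again [- c - P E], arranged so that its constant term [E_0 - c] is visible. *)
pose Y := (fpsC b - fpsC d * fpsX) * E; pose G := E - fpsC c + Y * fpsX.
rewrite (hankel_cfrac F a b E G 1); last by rewrite -EP /G /Y /E_denom; ring.
move: H1; rewrite /hankel !det_mx11 !mxE => H1; congr (_ * _).
by rewrite -[LHS]/(E 0%N - c + (Y * fpsX) 0%N) fps_mulX0 addr0 -H1.
Qed.

Theorem theorem1 (F : fieldType) (a b c d : F) (E : fps F)
    (E_eq : E = fpsC a /
      (E * fpsX ^+ 2 * (fpsC d * fpsX ^+ 2 - fpsC b * fpsX - 1)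
       + fpsC c * fpsX ^+ 2 + fpsC b * fpsX + 1))
    (H_neq0 : forall n : nat, hankel E n != 0) :
  forall n : nat,
    hankel E (2 * n + 1) =
      a ^+ ((n + 1) ^ 2) * (c + d - a) ^+ (n ^ 2) * seqB a c d n
    /\ hankel E (2 * n) =
      (-1) ^+ n * a ^+ (n * (n + 1)) * (c + d - a) ^+ (n * (n - 1))
        * seqB a c d n.
Proof.
have {E_eq} : E * E_denom b c d E = fpsC a.
  by rewrite {1}E_eq mulrVK // E_denom_unit.
move=> E_eq n; elim: n a c d E E_eq H_neq0 => [|n IHn] a c d E E_eq H_neq0.
  by rewrite (hankel1_E _ _ _ _ _ _ E_eq) hankel0; split => /=; ring.
have B1 : c - a != 0.
  have := H_neq0 2%N; rewrite (hankel2_E _ _ _ _ _ _ E_eq).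
  by rewrite mulf_eq0 -opprB oppr_eq0 => /norP[].
pose s := a * d / (c - a).
have sE : a * d = s * (c - a) by rewrite /s divfK.
have [E' E'_eq H_E] := E_step _ _ _ _ _ _ _ sE E_eq.
have [|IH1 IH2] := IHn _ _ _ _ E'_eq.
  by move=> m; have := H_neq0 m.+2; rewrite H_E mulf_eq0 => /norP[].
(* For the new parameters [c + d - a] becomes [c - a]; [powE] below is then the invariance of alpha,
   raised to the power [k]. *)
have IH_eq : c + 2 * s - s - (a + s) = c - a by ring.
rewrite IH_eq in IH1 IH2.
have powE k : (a + s) ^+ k * (c - a) ^+ k = a ^+ k * (c + d - a) ^+ k.
  by rewrite -!exprMn; congr (_ ^+ _); ring: sE.
rewrite (_ : (2 * n.+1 + 1 = (2 * n + 1).+2)%N); last by lia.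
rewrite (_ : (2 * n.+1 = (2 * n).+2)%N); last by lia.
rewrite !H_E IH1 IH2 !(seqB_step _ _ _ _ s) //.
move: (seqB (a + s) (c + 2 * s) (- s) n) (a + s) powE => x a' powE.
rewrite -(opprB c a).
move: (c - a) (c + d - a) powE => g y powE; split.
  (* Of all the factors [g], as many as there are factors [a'] pair with them through [powE]; the
     one left over turns [x] into [B_(n+1)]. *)
  have gE : g ^+ (2 * n + 1).+1 * g ^+ (n ^ 2) = g ^+ ((n + 1) ^ 2) * g.
    by rewrite -exprD -exprSr; congr (_ ^+ _); lia.
  have aE : a ^+ ((n.+1 + 1) ^ 2) = a ^+ (2 * n + 1).+2 * a ^+ ((n + 1) ^ 2).
    by rewrite -exprD; congr (_ ^+ _); lia.
  have NgE : (- g) ^+ (2 * n + 1).+1 = g ^+ (2 * n + 1).+1.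
    by rewrite (_ : (2 * n + 1).+1 = 2 * n.+1)%N ?exprM ?sqrrN //; lia.
  rewrite aE NgE -[n.+1]addn1; have := esym (powE ((n + 1) ^ 2)%N); move: gE.
  move: (g ^+ (2 * n + 1).+1) (g ^+ (n ^ 2)) (g ^+ ((n + 1) ^ 2)) => g1 g2 g3.
  move: (a ^+ (2 * n + 1).+2) (a ^+ ((n + 1) ^ 2)) => a1 a2.
  move: (y ^+ _) (a' ^+ _) => y1 a'1 gE pE; ring: gE pE.
(* The same count; the truncated [n - 1] is harmless at [n = 0] because of the factor [n]. The odd
   power of [- g] now supplies the new sign. *)
have gE : g ^+ (2 * n).+1 * g ^+ (n * (n - 1)) = g ^+ (n * (n + 1)) * g.
  by rewrite -exprD -exprSr; congr (_ ^+ _); nia.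
have aE : a ^+ (n.+1 * (n.+1 + 1)) = a ^+ (2 * n).+2 * a ^+ (n * (n + 1)).
  by rewrite -exprD; congr (_ ^+ _); lia.
have NgE : (- g) ^+ (2 * n).+1 = - g ^+ (2 * n).+1.
  by rewrite exprSr [in RHS]exprSr !exprM sqrrN mulrN.
have yE : (n.+1 * (n.+1 - 1) = n * (n + 1))%N by lia.
rewrite aE NgE yE [(-1) ^+ n.+1]exprS.
have := esym (powE (n * (n + 1))%N); move: gE.
move: (g ^+ (2 * n).+1) (g ^+ (n * (n - 1))) (g ^+ (n * (n + 1))) => g1 g2 g3.
move: (a ^+ (2 * n).+2) (a ^+ (n * (n + 1))) => a1 a2.
move: (y ^+ _) (a' ^+ _) ((-1) ^+ n) => y1 a'1 e gE pE; ring: gE pE.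
Qed.
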